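(* Let $\Gamma$ be a compact group and let $\rho_n\colon\Gamma\to\mathrm{GL}_d(\mathbb{C}_p)$ be a uniformly trace-convergent sequence of continuous representations. Let $G_n$ denote the Zariski closure of $\rho_n(\Gamma)$ in $\mathrm{GL}_d$. Then $|\pi_0(G_n)|$ is bounded independently of $n$.
   Context: $\mathbb{C}_p$ is the completion of an algebraic closure of $\mathbb{Q}_p$. The sequence is uniformly trace-convergent if the functions $g\mapsto\mathrm{tr}(\rho_n(g))$ converge uniformly on $\Gamma$. $\pi_0(G_n)=G_n/G_n^\circ$ is the component group. *)

(* Defs.v *)
From HB Require Import structures.
From mathcomp Require Import all_boot all_order all_algebra.
From mathcomp Require Import all_classical all_reals all_analysis.
From mathcomp Require Import (canonicals) mpoly.

Set Implicit Arguments.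
Unset Strict Implicit.
Unset Printing Implicit Defensive.

Import Order.TTheory GRing.Theory Num.Theory.

Local Open Scope classical_set_scope.
Local Open Scope ring_scope.

HB.mixin Record Group_Topological_isTopGroup G of Group G & Topological G := {
  mulg_continuous : continuous (fun xy : G * G => (xy.1 * xy.2)%g) ;
  invg_continuous : continuous (fun x : G => (x^-1)%g)
}.

#[short(type="topGroupType")]
HB.structure Definition TopGroup :=
  {G of Group G & Topological G & Group_Topological_isTopGroup G}.

(* Fields with a nonarchimedean absolute value. *)
HB.mixin Record Field_isValued (R : realType) K of GRing.Field K := {
  absv : K -> R ;
  absv_ge0 : forall x, 0 <= absv x ;
  absv_eq0 : forall x, absv x = 0 <-> x = 0 ;
  absvM : forall x y, absv (x * y) = absv x * absv y ;
  absvD_max : forall x y, absv (x + y) <= Num.max (absv x) (absv y)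
}.

#[short(type="valuedFieldType")]
HB.structure Definition ValuedField (R : realType) :=
  {K of GRing.Field K & Field_isValued R K}.

(* The topology of a valued field is that of the metric |x - y|. *)
Section valued_field_metric.
Variables (R : realType) (K : valuedFieldType R).
Implicit Types x y z : K.

Definition absv_dist x y : R := absv (x - y).

Lemma absv1 : absv (1 : K) = 1 :> R.
Proof.
have nz1 : absv (1 : K) != 0 :> R.
  by apply/eqP => /absv_eq0/eqP; rewrite oner_eq0.
by apply: (mulfI nz1); rewrite -absvM !mulr1.
Qed.

Lemma absvN x : absv (- x) = absv x :> R.
Proof.
have N1 : absv (-1 : K) = 1 :> R.
  by apply/eqP; rewrite -sqrp_eq1 ?absv_ge0// expr2 -absvM mulrNN mulr1 absv1.
by rewrite -mulN1r absvM N1 mul1r.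
Qed.

Lemma absv_distxx x : absv_dist x x = 0.
Proof. by rewrite /absv_dist subrr; apply/absv_eq0. Qed.

Lemma absv_dist_positivity x y : absv_dist x y = 0 -> x = y.
Proof. by move/absv_eq0/eqP; rewrite subr_eq0 => /eqP. Qed.

Lemma absv_dist_sym x y : absv_dist x y = absv_dist y x.
Proof. by rewrite /absv_dist -absvN opprB. Qed.

Lemma absv_dist_triangle y x z : absv_dist x z <= absv_dist x y + absv_dist y z.
Proof.
rewrite /absv_dist -[x - z](subrKA y) addrC (le_trans (absvD_max _ _))// addrC.
by rewrite ge_max lerDl lerDr !absv_ge0.
Qed.

HB.instance Definition _ :=
  isMetric.Build R K absv_distxx absv_dist_positivity absv_dist_sym absv_dist_triangle.

End valued_field_metric.

Section padic.
Variable R : realType.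

Definition padic_abs (p : nat) (q : rat) : R :=
  if q == 0 then 0
  else p%:R ^ ((logn p `|denq q|%N)%:Z - (logn p `|numq q|%N)%:Z).

Definition is_complete (T : uniformType) :=
  forall F : set_system T, ProperFilter F -> cauchy F -> exists l : T, F --> l.

Definition is_completion (K : fieldType) (abs : K -> R)
    (L : valuedFieldType R) (f : {rmorphism K -> L}) :=
  [/\ forall x, absv (f x) = abs x, dense (range f) & is_complete L].

Definition is_algebraic_closure (K L : fieldType) (f : {rmorphism K -> L}) :=
  GRing.closed_field_axiom L /\ forall x : L, algebraicOver f x.

(* [C] is the completion of an algebraic closure [Qpbar] of [Qp], where [Qp] is
   the completion of the rationals for the p-adic absolute value and [Qpbar]
   carries the absolute value extending that of [Qp]. This determines [C] up to
   isometric isomorphism. *)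
Definition is_Cp (p : nat) (C : valuedFieldType R) : Prop :=
  exists (Qp Qpbar : valuedFieldType R) (h : {rmorphism rat -> Qp})
         (i : {rmorphism Qp -> Qpbar}) (j : {rmorphism Qpbar -> C}),
  [/\ is_completion (padic_abs p) h,
      is_algebraic_closure i,
      forall x, absv (i x) = absv x :> R &
      is_completion absv j].

End padic.

(* The d x d matrices with the Zariski topology of affine d^2-space, as opposed
   to the product topology that ['M[K]_d] inherits from a topology on K. *)
Definition zariski_mx (K : fieldType) (d : nat) : Type := 'M[K]_d.

HB.instance Definition _ (K : fieldType) (d : nat) :=
  Choice.copy (zariski_mx K d) 'M[K]_d.

Section zariski_topology.
Variables (K : fieldType) (d : nat).
Local Notation mxpoly := (mpoly.mpoly (d * d) K).

Definition poly_eval (A : 'M[K]_d) (P : mxpoly) : K :=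
  mpoly.meval (fun k => mxvec A 0 k) P.

Lemma poly_evalM A P Q : poly_eval A (P * Q) = poly_eval A P * poly_eval A Q.
Proof. exact: mpoly.mevalM. Qed.

Definition zero_locus (I : set mxpoly) : set (zariski_mx K d) :=
  [set A | forall P, I P -> poly_eval A P = 0].

Definition zariski_open : set_system (zariski_mx K d) :=
  [set U | exists I : set mxpoly, U = ~` zero_locus I].

Lemma zariski_openT : zariski_open setT.
Proof.
exists [set 1]; rewrite -[LHS]setC0; congr (~` _).
apply/esym/seteqP; split=> // A /(_ 1 erefl)/eqP.
by rewrite /poly_eval mpoly.meval1 oner_eq0.
Qed.

Lemma zariski_openI : setI_closed zariski_open.
Proof.
move=> _ _ [I ->] [J ->].
exists [set P | exists Q1 Q2, [/\ I Q1, J Q2 & P = Q1 * Q2]].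
rewrite -setCU; congr (~` _); apply/seteqP; split=> A.
  case=> zA _ [Q1 [Q2 [IQ1 JQ2 ->]]]; rewrite poly_evalM.
    by rewrite (zA _ IQ1) mul0r.
  by rewrite (zA _ JQ2) mulr0.
move=> zA; apply: contrapT => /not_orP[/existsNP[Q1 /not_implyP[IQ1 /eqP nz1]]].
move=> /existsNP[Q2 /not_implyP[JQ2 /eqP nz2]].
have /eqP := zA (Q1 * Q2) (ex_intro _ Q1 (ex_intro _ Q2 (And3 IQ1 JQ2 erefl))).
by rewrite poly_evalM mulf_eq0 (negbTE nz1) (negbTE nz2).
Qed.

Lemma zariski_open_bigU (T : Type) (f : T -> set (zariski_mx K d)) :
  (forall t, zariski_open (f t)) -> zariski_open (\bigcup_t f t).
Proof.
move=> /choice[I fE]; exists (\bigcup_t I t).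
under eq_bigcupr do rewrite fE.
rewrite -setC_bigcap; congr (~` _); apply/seteqP; split=> A zA.
  by move=> P [t _ ItP]; exact: zA ItP.
by move=> t _ P ItP; apply: zA; exists t.
Qed.

HB.instance Definition _ := isOpenTopological.Build (zariski_mx K d)
  zariski_openT zariski_openI zariski_open_bigU.

Definition GL : set (zariski_mx K d) := [set A : 'M[K]_d | A \in unitmx].

(* Closure of [S] in the subspace [GL]. *)
Definition zariski_closure_GL (S : set 'M[K]_d) : set 'M[K]_d :=
  GL `&` closure (S : set (zariski_mx K d)).

Definition identity_component (G : set 'M[K]_d) : set 'M[K]_d :=
  connected_component (G : set (zariski_mx K d)) (1%:M : 'M[K]_d).

(* The underlying set of the component group: the left cosets in [G] of its
   identity component. *)
Definition pi0 (G : set 'M[K]_d) : set (set 'M[K]_d) :=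
  [set [set g *m h | h in identity_component G] | g in G].

End zariski_topology.

Section representations.
Variables (R : realType) (K : valuedFieldType R) (d : nat) (Gamma : topGroupType).

(* A homomorphism Gamma -> GL_d(K); invertibility of the values is implied. *)
Definition continuous_representation (rho : Gamma -> 'M[K]_d) :=
  [/\ rho 1%g = 1%:M, forall g h, rho (g * h)%g = rho g *m rho h &
      continuous rho].

Definition uniformly_trace_convergent (rho : nat -> Gamma -> 'M[K]_d) :=
  exists f : Gamma -> K, {uniform, (fun n g => \tr (rho n g)) @ \oo --> f}.

End representations.

(* Main.v *)
(* Sort the elements [g] of [Gamma] according to the function
   [h |-> tr rho_N (g h)], compared up to a small [eps]. Compactness gives
   finitely many classes, and uniform convergence lets the same classes serve for
   all [n >= N]. If [g] and [g'] share a class, then [A = rho_n (g'^-1 g)]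
   satisfies [|tr A^(k+1) - tr A^k| <= eps] for all [k], so the power traces of
   [B = A - 1] are small; by the Newton identities and Cayley-Hamilton the powers
   [B^j] decay like [|p|^(2j)]. Hence for every polynomial function [P] the
   sequence [k |-> P (A^k)] is the restriction of a p-adic analytic function,
   whose zeros are isolated: the product of two such nonzero sequences is nonzero.
   So the set of powers of [A] is Zariski connected and [A] lies in the identity
   component of [G_n]; the number of components is therefore at most the number
   of classes. *)
Require Import Defs.
From mathcomp Require Import all_boot all_order all_algebra perm.
From mathcomp Require Import all_classical all_reals all_analysis.
From mathcomp Require Import (canonicals) mpoly.
From mathcomp Require Import ring zify.

Set Implicit Arguments.
Unset Strict Implicit.
Unset Printing Implicit Defensive.

Import Order.TTheory GRing.Theory Num.Theory.

Local Open Scope classical_set_scope.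
Local Open Scope ring_scope.

(** * Ultrametric estimates *)

Section ultrametric.
Variables (R : realType) (K : valuedFieldType R).
Implicit Types (x y : K) (c : R).

Lemma absv0 : absv (0 : K) = 0 :> R.
Proof. exact/absv_eq0. Qed.

Lemma absv_neq0 x : x != 0 -> absv x != 0 :> R.
Proof. by apply: contra_neq => /absv_eq0. Qed.

Lemma absv_gt0 x : x != 0 -> (0 : R) < absv x.
Proof. by move=> x0; rewrite lt_def absv_neq0// absv_ge0. Qed.

Lemma absvX x n : absv (x ^+ n) = absv x ^+ n :> R.
Proof. by elim: n => [|n IH]; rewrite ?expr0 ?absv1// !exprS absvM IH. Qed.

Lemma absvV x : x != 0 -> absv x^-1 = (absv x)^-1 :> R.
Proof.
by move=> x0; apply: (mulfI (absv_neq0 x0)); rewrite -absvM !divff ?absv1 ?absv_neq0.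
Qed.

Lemma absvD_le c x y : absv x <= c -> absv y <= c -> absv (x + y) <= c.
Proof. by move=> xc yc; rewrite (le_trans (absvD_max x y))// ge_max xc. Qed.

Lemma absvB_le c x y : absv x <= c -> absv y <= c -> absv (x - y) <= c.
Proof. by move=> xc yc; rewrite absvD_le ?absvN. Qed.

Lemma absv_sum_le (I : Type) (r : seq I) (P : pred I) (F : I -> K) c :
  0 <= c -> (forall i, P i -> absv (F i) <= c) ->
  absv (\sum_(i <- r | P i) F i) <= c.
Proof.
move=> c0 Fc; apply: (big_ind (fun x => absv x <= c)) => //; first by rewrite absv0.
by move=> x y; exact: absvD_le.
Qed.

Lemma absvMn_le c x n : 0 <= c -> absv x <= c -> absv (x *+ n) <= c.
Proof.
move=> c0 xc; elim: n => [|n IH]; first by rewrite mulr0n absv0.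
by rewrite mulrS absvD_le.
Qed.

Lemma absv_nat_le1 n : absv (n%:R : K) <= 1 :> R.
Proof. by rewrite absvMn_le// absv1. Qed.

Lemma absvM_le c1 c2 x y : absv x <= c1 -> absv y <= c2 -> absv (x * y) <= c1 * c2.
Proof. by move=> xc yc; rewrite absvM ler_pM ?absv_ge0. Qed.

End ultrametric.

(** * Iterated forward differences of sequences *)

Section finite_differences.
Variables (R : realType) (K : valuedFieldType R).
Implicit Types (f g : nat -> K).

Definition fdiff f : nat -> K := fun k => f k.+1 - f k.

(** Induction on [k] through [f k.+1 = f k + fdiff f k] and Pascal's rule. Binomials with [j > k]
    vanish, so one sum serves all [k <= n] and can be read as an interpolation formula. *)
Lemma newton_forward f n k : (k <= n)%N ->
  f k = \sum_(j < n.+1) iter j fdiff f 0%N *+ 'C(k, j).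
Proof.
elim: k f => [|k IH] f kn.
  by rewrite big_ord_recl bin0 mulr1n big1 ?addr0.
have -> : f k.+1 = f k + fdiff f k by rewrite /fdiff addrC subrK.
rewrite (IH f (ltnW kn)) (IH (fdiff f) (ltnW kn)).
rewrite [X in _ + X]big_ord_recr /= (@bin_small k n)// addr0.
rewrite big_ord_recl [RHS]big_ord_recl /= !bin0 !mulr1n -addrA -big_split /=.
congr (_ + _); apply: eq_bigr => j _.
by rewrite /bump /= add1n binS mulrnDr /= -iterSr.
Qed.

(** Geometric decay of Mahler coefficients, asked at every base point [k] so that shifts and
    differences inherit it directly. *)
Definition diff_bounded (theta C : R) f :=
  forall j k, absv (iter j fdiff f k) <= C * theta ^+ j.

Variable theta : R.
Hypothesis theta_ge0 : 0 <= theta.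

Lemma iter_fdiffD j f g k :
  iter j fdiff (fun i => f i + g i) k = iter j fdiff f k + iter j fdiff g k.
Proof.
elim: j k => //= j IH k; rewrite /fdiff !IH; ring.
Qed.

Lemma diff_bounded_ge0 C f : diff_bounded theta C f -> 0 <= C.
Proof. by move=> /(_ 0%N 0%N); rewrite expr0 mulr1; apply: le_trans; rewrite absv_ge0. Qed.

Lemma diff_bounded_le C C' f : C <= C' -> diff_bounded theta C f ->
  diff_bounded theta C' f.
Proof. by move=> CC fC j k; rewrite (le_trans (fC _ _))// ler_wpM2r// exprn_ge0. Qed.

Lemma diff_bounded_cst c : diff_bounded theta (absv c) (fun=> c).
Proof.
case=> [|j] k; first by rewrite expr0 mulr1.
have -> : iter j.+1 fdiff (fun=> c) k = 0.
  elim: j k => [|j IH] k; first by rewrite /= /fdiff subrr.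
  by rewrite iterS {1}/fdiff !IH subrr.
by rewrite absv0 mulr_ge0 ?absv_ge0 ?exprn_ge0.
Qed.

Lemma diff_boundedD C f g : diff_bounded theta C f -> diff_bounded theta C g ->
  diff_bounded theta C (fun k => f k + g k).
Proof. by move=> fC gC j k; rewrite iter_fdiffD absvD_le. Qed.

Lemma diff_bounded_shift C f : diff_bounded theta C f ->
  diff_bounded theta C (fun k => f k.+1).
Proof.
move=> fC j k; suff -> : iter j fdiff (fun k => f k.+1) k = iter j fdiff f k.+1 by [].
by elim: j k => //= j IH k; rewrite /fdiff !IH.
Qed.

Lemma diff_bounded_fdiff C f : diff_bounded theta C f ->
  diff_bounded theta (C * theta) (fdiff f).
Proof. by move=> fC j k; rewrite -iterSr -mulrA -exprS. Qed.

(* Leibniz rule: the difference of [f * g] is [fdiff f * shift g + f * fdiff g]. *)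
Lemma diff_boundedM C C' f g : diff_bounded theta C f -> diff_bounded theta C' g ->
  diff_bounded theta (C * C') (fun k => f k * g k).
Proof.
move=> fC gC j; elim: j C C' f g fC gC => [|j IH] C C' f g fC gC k.
  rewrite expr0 mulr1; apply: absvM_le; first by have := fC 0%N k; rewrite expr0 mulr1.
  by have := gC 0%N k; rewrite expr0 mulr1.
rewrite iterSr.
have -> : fdiff (fun k => f k * g k) =
          (fun k => fdiff f k * g k.+1 + f k * fdiff g k).
  by apply/funext => i; rewrite /fdiff; ring.
rewrite iter_fdiffD absvD_le//.
  have -> : C * C' * theta ^+ j.+1 = C * theta * C' * theta ^+ j.
    by rewrite exprS; ring.
  exact: IH (diff_bounded_fdiff fC) (diff_bounded_shift gC) k.
have -> : C * C' * theta ^+ j.+1 = C * (C' * theta) * theta ^+ j.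
  by rewrite exprS; ring.
exact: IH fC (diff_bounded_fdiff gC) k.
Qed.

End finite_differences.

(** * Gauss norms and division by roots *)

Section polynomial_bounds.
Variables (R : realType) (K : valuedFieldType R) (tau : R).
Hypotheses (tau_ge0 : 0 <= tau) (tau_le1 : tau <= 1).
Implicit Types (P Q : {poly K}) (C : R).

(** For [tau > 0]: the Gauss norm of [P] on the disc of radius [1 / tau] is at most [C]. *)
Definition coef_bounded C P := forall i, absv P`_i <= C * tau ^+ i.

(** The divisor has Gauss norm [1 / tau], whence the gain. Concretely, each coefficient of [Q] is
    the next one of [P] plus [z] times the next one of [Q], and the bound descends from the top
    degree. *)
Lemma coef_bounded_divXsubC C P Q (z : K) : 0 <= C -> absv z <= 1 ->
  P = Q * ('X - z%:P) -> coef_bounded C P -> coef_bounded (C * tau) Q.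
Proof.
move=> C0 z1 PE PC i.
have [n] := ubnP (size Q - i)%N; elim: n i => // n IH i Qn.
have [Qi|iQ] := leqP (size Q) i.
  by rewrite nth_default// absv0 !mulr_ge0 ?exprn_ge0.
have -> : Q`_i = P`_i.+1 + z * Q`_i.+1.
  by rewrite PE mulrBr coefB coefMX coefMC /=; ring.
rewrite -mulrA -exprS absvD_le//.
rewrite -[leRHS]mul1r absvM_le//.
apply: (le_trans (IH i.+1 _)); first by lia.
by rewrite -mulrA -exprS ler_wpM2l// ler_wiXn2l.
Qed.

Lemma horner_le C P x : 0 <= C -> absv x <= 1 -> coef_bounded C P -> absv P.[x] <= C.
Proof.
move=> C0 x1 PC; rewrite horner_coef absv_sum_le// => i _.
rewrite -[C]mulr1 absvM_le//.
  by rewrite (le_trans (PC _))// ler_piMr// exprn_ile1.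
by rewrite absvX exprn_ile1 ?absv_ge0.
Qed.

(** A nonarchimedean Schwarz lemma: each root divided off gains a factor [tau], and the removed
    factor [x - z] has absolute value at most 1. *)
Lemma horner_le_roots C P (zs : seq K) x : 0 <= C -> absv x <= 1 ->
  uniq zs -> all (root P) zs -> (forall z, z \in zs -> absv z <= (1 : R)) ->
  coef_bounded C P -> absv P.[x] <= C * tau ^+ size zs.
Proof.
move=> C0 x1; elim: zs C C0 P => [|z zs IH] C C0 P.
  by move=> _ _ _; rewrite expr0 mulr1; exact: horner_le.
move=> /= /andP[zzs uzs] /andP[/factor_theorem[Q PE] rzs] zs1 PC.
have Qbnd := coef_bounded_divXsubC C0 (zs1 z (mem_head _ _)) PE PC.
rewrite PE hornerM !hornerE /= exprS mulrA -[leRHS]mulr1 absvM_le//.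
  apply: IH => //; first exact: mulr_ge0.
    apply/allP => y yzs; have := allP rzs _ yzs.
    rewrite PE rootM root_XsubC => /orP[//|/eqP yz].
    by rewrite -yz yzs in zzs.
  by move=> y yzs; apply: zs1; rewrite inE yzs orbT.
by apply: absvB_le => //; exact: zs1 (mem_head _ _).
Qed.

Lemma coef_bounded1M P Q : (forall i, absv P`_i <= (1 : R)) ->
  (forall i, absv Q`_i <= (1 : R)) -> forall i, absv (P * Q)`_i <= (1 : R).
Proof.
move=> P1 Q1 i; rewrite coefM absv_sum_le// => j _.
by rewrite -[leRHS]mulr1 absvM_le.
Qed.

End polynomial_bounds.

(** * Zeros of sequences with rapidly decaying differences *)

Lemma logn_fact_le p n : prime p -> (logn p n`! <= n)%N.
Proof.
move=> p_pr; rewrite logn_fact//.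
(* The extra term [n %/ p ^ m] pays for the next summand of Legendre's formula, since
   [2 * (n %/ p ^ m.+1) <= n %/ p ^ m]. *)
suff H m : (\sum_(1 <= k < m.+1) n %/ p ^ k + n %/ p ^ m <= n)%N.
  by apply: leq_trans (H n); rewrite leq_addr.
elim: m => [|m IH]; first by rewrite big_geq// expn0 divn1.
apply: leq_trans IH; rewrite big_nat_recr//= -addnA leq_add2l addnn -muln2.
rewrite expnSr divnMA (leq_trans _ (leq_divM _ p))// leq_mul2l prime_gt1// orbT//.
Qed.

Section padic_sequences.
Variables (R : realType) (K : valuedFieldType R) (p : nat).
Hypothesis p_pr : prime p.
Hypothesis absv_nat : forall n, (0 < n)%N ->
  absv (n%:R : K) = (p%:R^-1 : R) ^+ logn p n.

Implicit Types f g : nat -> K.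
Local Notation tau := (p%:R^-1 : R).

Lemma pinv_gt0 : 0 < tau.
Proof. by rewrite invr_gt0 ltr0n prime_gt0. Qed.

Lemma pinv_le1 : tau <= 1.
Proof. by rewrite invf_le1 ?ler1n ?ltr0n prime_gt0. Qed.

Lemma valued_natr_eq0 n : (n%:R == 0 :> K) = (n == 0)%N.
Proof.
case: n => [|n]; first by rewrite !eqxx.
apply/negbTE/eqP => n0; have := @absv_nat n.+1 isT.
rewrite n0 absv0 => /esym/eqP; rewrite expf_eq0 => /andP[_].
by rewrite gt_eqF// pinv_gt0.
Qed.

Lemma valued_natr_inj : injective (fun n => n%:R : K).
Proof.
move=> m n /=; wlog mn : m n / (m <= n)%N => [H|] mnE.
  by case: (leqP m n) => [/H->//|/ltnW/H->].
apply/eqP; rewrite eqn_leq mn/= -subn_eq0 -valued_natr_eq0 natrB// mnE subrr//.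
Qed.

Definition ffact_poly j : {poly K} := \prod_(i < j) ('X - i%:R%:P).

Lemma ffact_polyE j k : (ffact_poly j).[k%:R] = (k ^_ j)%:R.
Proof.
elim: j => [|j IH]; first by rewrite /ffact_poly big_ord0 hornerE ffactn0.
rewrite /ffact_poly big_ord_recr hornerM -/(ffact_poly j) IH !hornerE/= ffactnSr.
rewrite natrM; have [jk|kj] := leqP j k; first by rewrite natrB.
by rewrite ffact_small// !mul0r.
Qed.

Lemma ffact_poly_coef_le1 j i : absv (ffact_poly j)`_i <= (1 : R).
Proof.
rewrite /ffact_poly.
apply: (big_ind (fun P : {poly K} => forall i, absv P`_i <= (1 : R))).
- by move=> k; rewrite coef1 absv_nat_le1.
- by move=> P Q; exact: coef_bounded1M.
move=> k _ l; rewrite coefB coefX coefC absvB_le ?absv_nat_le1//.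
by case: ifP => _; rewrite ?absv_nat_le1// absv0.
Qed.

Lemma size_ffact_poly j : size (ffact_poly j) = j.+1.
Proof. by rewrite /ffact_poly size_prod_XsubC -[index_enum _]enumT size_enum_ord. Qed.

Definition newton_poly (f : nat -> K) n : {poly K} :=
  \sum_(j < n.+1) (iter j (@fdiff R K) f 0%N / j`!%:R) *: ffact_poly j.

Lemma newton_polyE f n k : (k <= n)%N -> (newton_poly f n).[k%:R] = f k.
Proof.
move=> kn; rewrite (newton_forward f kn) /newton_poly horner_sum.
apply: eq_bigr => j _; rewrite hornerZ ffact_polyE -bin_ffact mulnC natrM.
have j0 : j`!%:R != 0 :> K by rewrite valued_natr_eq0 -lt0n fact_gt0.
by rewrite -[RHS]mulr_natr mulrA divfK.
Qed.

(** The reason for the square: dividing by [j!] costs at most [j] factors [tau] by [logn_fact_le],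
    so of [tau ^+ (2 * j)] there remains [tau ^+ j], which is at most [tau ^+ i] for [i <= j]. *)
Lemma newton_poly_bounded f n C : diff_bounded (tau ^+ 2) C f ->
  coef_bounded tau C (newton_poly f n).
Proof.
move=> fC i; have C0 := diff_bounded_ge0 fC.
have tau0 := ltW pinv_gt0; have tau1 := pinv_le1.
rewrite coef_sum absv_sum_le// => [|j _]; first by rewrite mulr_ge0 ?exprn_ge0.
rewrite coefZ; have [ij|ji] := leqP i j; last first.
  by rewrite nth_default ?size_ffact_poly// mulr0 absv0 mulr_ge0 ?exprn_ge0.
rewrite -[leRHS]mulr1 absvM_le ?ffact_poly_coef_le1//.
rewrite absvM absvV; last by rewrite valued_natr_eq0 -lt0n fact_gt0.
rewrite absv_nat ?fact_gt0// ler_pdivrMr ?exprn_gt0 ?pinv_gt0//.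
rewrite (le_trans (fC j 0%N))// -mulrA ler_wpM2l// -exprD -exprM.
by rewrite ler_wiXn2l// mul2n -addnn leq_add// logn_fact_le.
Qed.

(* On [[0, n]] the sequence agrees with its Newton polynomial, out of which the
   zeros can be divided, each division gaining a factor [tau]. *)
Lemma absv_le_zeros f C (ks : seq nat) k : diff_bounded (tau ^+ 2) C f ->
  uniq ks -> (forall i, i \in ks -> f i = 0) ->
  absv (f k) <= C * tau ^+ size ks.
Proof.
move=> fC uks ks0; pose n := (k + \max_(i <- ks) i)%N.
rewrite -(@newton_polyE f n k) ?leq_addr// -(size_map (fun i => i%:R : K) ks).
apply: horner_le_roots.
- exact/ltW/pinv_gt0.
- exact: pinv_le1.
- exact: diff_bounded_ge0 fC.
- exact: absv_nat_le1.
- by rewrite map_inj_uniq//; exact: valued_natr_inj.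
- apply/allP => _ /mapP[i iks ->]; rewrite /root newton_polyE ?ks0//.
  by rewrite (leq_trans (@leq_bigmax_seq _ _ xpredT id i iks isT))// leq_addl.
- by move=> _ /mapP[i _ ->]; exact: absv_nat_le1.
- exact: newton_poly_bounded.
Qed.

Lemma pinv_expr_small (C e : R) : 0 < e -> exists m, C * tau ^+ m < e.
Proof.
move=> e0; have [C0|C0] := leP C 0.
  by exists 0%N; rewrite expr0 mulr1 (le_lt_trans C0).
exists (Num.truncn (C / e)).+1; set m := _.+1.
rewrite exprVn ltr_pdivrMr ?exprn_gt0 ?ltr0n ?prime_gt0//.
rewrite mulrC -ltr_pdivrMr// (lt_trans (truncnS_gt _))// -natrX ltr_nat.
by rewrite ltn_expl// prime_gt1.
Qed.

(** Pigeonhole: among the first [m + m'] naturals, [f] has [m] zeros or [g] has [m']. By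
    [absv_le_zeros] either case contradicts a nonzero value once [m] and [m'] are large. *)
Lemma diff_bounded_mul_eq0 f g C C' :
  diff_bounded (tau ^+ 2) C f -> diff_bounded (tau ^+ 2) C' g ->
  (forall k, f k * g k = 0) -> (forall k, f k = 0) \/ (forall k, g k = 0).
Proof.
move=> fC gC fg0; apply: contrapT => /not_orP[/existsNP[k /eqP fk] /existsNP[l /eqP gl]].
have [m Hm] := pinv_expr_small C (absv_gt0 fk).
have [m' Hm'] := pinv_expr_small C' (absv_gt0 gl).
pose r := iota 0 (m + m').
pose zf := [seq i <- r | f i == 0]; pose zg := [seq i <- r | f i != 0].
have szfg : (size zf + size zg)%N = (m + m')%N.
  by rewrite !size_filter count_predC size_iota.
have tau0 := ltW pinv_gt0; have tau1 := pinv_le1.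
have [mzf|mzf] := leqP m (size zf).
  have H := @absv_le_zeros f C zf k fC.
  suff : absv (f k) < absv (f k) by rewrite ltxx.
  apply: le_lt_trans Hm; apply: le_trans (H _ _) _.
  - by rewrite filter_uniq ?iota_uniq.
  - by move=> i; rewrite mem_filter => /andP[/eqP].
  - by rewrite ler_wpM2l ?(diff_bounded_ge0 fC)// ler_wiXn2l.
have H := @absv_le_zeros g C' zg l gC.
suff : absv (g l) < absv (g l) by rewrite ltxx.
apply: le_lt_trans Hm'; apply: le_trans (H _ _) _.
- by rewrite filter_uniq ?iota_uniq.
- move=> i; rewrite mem_filter => /andP[fi _]; apply: (mulfI fi).
  by rewrite fg0 mulr0.
- rewrite ler_wpM2l ?(diff_bounded_ge0 gC)// ler_wiXn2l//; lia.
Qed.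

End padic_sequences.

(** * Newton identities and Cayley-Hamilton via the adjugate of X - B *)

Section newton_identities.
Variables (K : comNzRingType) (d : nat).
Implicit Types B : 'M[K]_d.

Lemma deriv_prod_seq (I : eqType) (r : seq I) (F : I -> {poly K}) : uniq r ->
  (\prod_(i <- r) F i)^`() = \sum_(i <- r) (F i)^`() * \prod_(j <- r | i != j) F j.
Proof.
elim: r => [|i r IH] /=; first by rewrite !big_nil derivC.
case/andP=> ir ur; rewrite !big_cons derivM IH// eqxx /=.
congr (_ * _ + _).
  rewrite big_seq_cond [RHS]big_seq_cond; apply: eq_bigl => j.
  by rewrite andbT; case: eqVneq => [<-|]; rewrite ?(negbTE ir) ?andbT.
rewrite big_distrr /= [LHS]big_seq [RHS]big_seq; apply: eq_bigr => k kr.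
rewrite big_cons; case: eqVneq => [ki|_]; first by rewrite -ki kr in ir.
by rewrite mulrCA.
Qed.

(** Jacobi's formula. In the Leibniz expansion only the entries with [s i = i] depend on X; after
    exchanging the sums, each [i] contributes the expansion of its diagonal cofactor. *)
Lemma deriv_char_poly B : (char_poly B)^`() = \tr (\adj (char_poly_mx B)).
Proof.
rewrite /char_poly /determinant raddf_sum /=.
transitivity (\sum_(s : 'S_d) \sum_(i | s i == i)
    (-1) ^+ s * \prod_(k | i != k) char_poly_mx B k (s k)).
  apply: eq_bigr => s _; rewrite derivM.
  have -> : ((-1) ^+ s : {poly K})^`() = 0.
    by rewrite -[(-1) ^+ s]mulr1 mulr_sign; case: (s : bool); rewrite ?derivN derivC ?oppr0.
  rewrite mul0r add0r deriv_prod_seq ?index_enum_uniq// big_distrr [RHS]big_mkcond.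
  apply: eq_bigr => i _; rewrite !mxE derivB derivC subr0 derivMn derivX eq_sym.
  by case: eqP => _ /=; rewrite ?mul1r// mul0r mulr0.
rewrite (exchange_big_dep xpredT)//= /mxtrace; apply: eq_bigr => i _.
by rewrite mxE expand_cofactor.
Qed.

Let adjc B k : 'M[K]_d := map_mx (coefp k) (\adj (char_poly_mx B)).

Lemma coef_char_poly_mul_adj B k :
  ((char_poly B)`_k)%:M = (if k is k'.+1 then adjc B k' else 0) - B *m adjc B k.
Proof.
have /matrixP E : 'X *: \adj (char_poly_mx B) -
    map_mx polyC B *m \adj (char_poly_mx B) = (char_poly B)%:M.
  by rewrite -mul_scalar_mx -mulmxBl mul_mx_adj.
apply/matrixP => a b; have /(congr1 (fun P : {poly K} => P`_k)) := E a b.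
rewrite !mxE coefMn => <-; rewrite coefB coefXM coef_sum.
congr (_ - _); first by case: k => [|k]; rewrite !mxE.
by apply: eq_bigr => c _; rewrite !mxE coefCM.
Qed.

(** Unrolls the recurrence of [coef_char_poly_mul_adj], which gives [adjc B k] from [adjc B k.+1],
    downwards from a degree where both sides vanish. *)
Lemma adjcE B k : adjc B k = \sum_(i < d.+1) (char_poly B)`_(k + i).+1 *: B ^+ i.
Proof.
pose m := (d + \max_a \max_b size (\adj (char_poly_mx B) a b))%N.
have adjc0 l : (m <= l)%N -> adjc B l = 0.
  move=> ml; apply/matrixP => a b; rewrite [LHS]mxE [RHS]mxE /= nth_default//.
  apply: leq_trans ml; apply: leq_trans (leq_addl _ _).
  apply: leq_trans (leq_bigmax (F := fun a => \max_b size (\adj (char_poly_mx B) a b)) a).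
  exact: (leq_bigmax (F := fun b => size (\adj (char_poly_mx B) a b))).
have [n] := ubnP (m - k)%N; elim: n k => // n IH k kn.
have [mk|km] := leqP m k.
  rewrite adjc0// big1// => i _; rewrite nth_default ?scale0r// size_char_poly ltnS.
  by rewrite (leq_trans _ (leq_addr _ _))// (leq_trans _ mk)// leq_addr.
have := coef_char_poly_mul_adj B k.+1 => /= /esym/eqP.
rewrite subr_eq => /eqP ->; rewrite IH; last by lia.
rewrite [RHS]big_ord_recl addn0 expr0 -scalemx1; congr (_ + _).
rewrite mulmx_sumr big_ord_recr /=.
rewrite [X in X *: _]nth_default ?size_char_poly; last first.
  by rewrite !ltnS addSn ltnW// ltnS leq_addl.
rewrite scale0r mulmx0 addr0; apply: eq_bigr => i _.
by rewrite -scalemxAr /bump /= add1n addSn addnS exprS.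
Qed.

(* The library's [Cayley_Hamilton] excludes [d = 0]. *)
Lemma Cayley_Hamilton_sum B : \sum_(i < d.+1) (char_poly B)`_i *: B ^+ i = 0.
Proof.
have /= E := coef_char_poly_mul_adj B 0%N.
rewrite big_ord_recl expr0 scalemx1 E adjcE sub0r big_ord_recr /=.
rewrite [X in X *: _]nth_default ?size_char_poly// scale0r addr0 mulmx_sumr.
rewrite addrC; apply/eqP; rewrite subr_eq0; apply/eqP; apply: eq_bigr => i _.
by rewrite -scalemxAr /bump /= add1n add0n exprS.
Qed.

(** The trace of [coef_char_poly_mul_adj]: by [deriv_char_poly] the adjugate term has trace [j]
    times the coefficient, which turns [d] into [d - j]. The right side involves only coefficients
    of index above [j]. *)
Lemma newton_identity B j : (j <= d)%N ->
  (d - j)%:R * (char_poly B)`_j =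
  - \sum_(i < d.+1) (char_poly B)`_(j + i).+1 * \tr (B ^+ i.+1).
Proof.
have trB k : \tr (B *m adjc B k) =
    \sum_(i < d.+1) (char_poly B)`_(k + i).+1 * \tr (B ^+ i.+1).
  rewrite adjcE mulmx_sumr raddf_sum /=; apply: eq_bigr => i _.
  by rewrite -scalemxAr mxtraceZ exprS.
move=> jd; rewrite -trB natrB// mulrBl.
have /(congr1 mxtrace) := coef_char_poly_mul_adj B j.
rewrite mxtrace_scalar raddfB /= => E; rewrite !mulr_natl E.
case: j jd {E} => [|j] jd; first by rewrite mulr0n mxtrace0 subr0 sub0r.
have -> : \tr (adjc B j) = (char_poly B)`_j.+1 *+ j.+1.
  rewrite -coef_deriv deriv_char_poly coef_sum.
  by apply: eq_bigr => i _; rewrite mxE.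
by rewrite addrAC subrr sub0r.
Qed.

End newton_identities.

(** * Matrices whose power traces vary little *)

Section near_unipotent.
Variables (R : realType) (K : valuedFieldType R) (d : nat).
Variables (theta eps : R) (A : 'M[K]_d).
Hypotheses (theta_gt0 : 0 < theta) (theta_le1 : theta <= 1) (eps_gt0 : 0 < eps).
Hypothesis eps_small : forall m, (0 < m <= d)%N -> eps <= theta ^+ d * absv (m%:R : K).
Hypothesis trA : forall k, absv (\tr (A ^+ k.+1) - \tr (A ^+ k)) <= eps.

Let B := A - 1.

Let theta_ge0 : 0 <= theta. Proof. exact: ltW. Qed.
Let eps_ge0 : 0 <= eps. Proof. exact: ltW. Qed.

(** The induction carries a factor [A ^+ k]: replacing one [B] by [A - 1] gives a difference of two
    traces already bounded by [eps], and the ultrametric inequality loses nothing. *)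
Lemma trace_nilpart_le i : absv (\tr (B ^+ i.+1)) <= eps.
Proof.
suff H k : absv (\tr (A ^+ k * B ^+ i.+1)) <= eps.
  by have := H 0%N; rewrite expr0 mul1r.
elim: i k => [|i IH] k.
  rewrite expr1 /B mulrBr mulr1 -exprSr raddfB; exact: trA.
rewrite exprS {1}/B mulrA mulrBr mulr1 mulrBl -exprSr raddfB /=.
by rewrite absvB_le.
Qed.

(** Downward induction from the leading coefficient 1. In [newton_identity] the higher coefficients
    have size at most 1 and the traces at most [eps]; [eps_small] absorbs the division by
    [d - j]. *)
Lemma char_poly_nilpart_le j : (j < d)%N -> absv (char_poly B)`_j <= theta ^+ d.
Proof.
have [n] := ubnP (d - j)%N; elim: n j => // n IH j dn jd.
have coef1 l : (j < l)%N -> absv (char_poly B)`_l <= (1 : R).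
  move=> jl; case: (ltngtP l d) => [ld|dl|->].
  - by rewrite (le_trans (IH l _ ld)) ?exprn_ile1//; lia.
  - by rewrite nth_default ?size_char_poly// absv0.
  - have /monicP := char_poly_monic B.
    by rewrite /lead_coef size_char_poly /= => ->; rewrite absv1.
have dj0 : (0 < d - j <= d)%N by lia.
have dj : absv ((d - j)%:R : K) != 0 :> R.
  by apply/eqP => dj_0; have := eps_small dj0; rewrite dj_0 mulr0 leNgt eps_gt0.
rewrite -(ler_pM2r (_ : 0 < absv ((d - j)%:R : K))) ?lt_def ?dj ?absv_ge0//.
apply: le_trans (eps_small dj0); rewrite mulrC -absvM newton_identity ?(ltnW jd)//.
rewrite absvN absv_sum_le// => i _; rewrite -[eps]mul1r absvM_le//.
  by rewrite coef1// ltnS leq_addr.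
exact: trace_nilpart_le.
Qed.

(** For [j >= d], Cayley-Hamilton expresses [B ^+ j] through powers of exponent at least [j - d];
    the coefficients, of size at most [theta ^+ d], restore the decay lost by lowering the
    exponent. *)
Lemma nilpart_exp_le : exists2 C : R, 0 <= C &
  forall j a b, absv ((B ^+ j) a b) <= C * theta ^+ j.
Proof.
pose F i a b : R := absv ((B ^+ i) a b) / theta ^+ i.
have F0 i a b : 0 <= F i a b by rewrite divr_ge0 ?absv_ge0 ?exprn_ge0.
(* A sum of nonnegative terms, hence at least each of them; this settles the exponents below [d]. *)
pose C := \sum_(i < d) \sum_a \sum_b F i a b.
have C0 : 0 <= C by do 3 (apply: sumr_ge0 => ? _).
exists C => // j; have [n] := ubnP j; elim: n j => // n IH j jn a b.
have [jd|dj] := ltnP j d.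
  rewrite -ler_pdivrMr ?exprn_gt0// /C.
  rewrite (bigD1 (Ordinal jd))//= (bigD1 a)//= (bigD1 b)//= -!addrA lerDl.
  by do 2?[apply: addr_ge0]; do 3?(apply: sumr_ge0 => ? _).
have -> : B ^+ j = - \sum_(i < d) (char_poly B)`_i *: B ^+ (j - d + i).
  have := Cayley_Hamilton_sum B; rewrite big_ord_recr /=.
  have /monicP := char_poly_monic B.
  rewrite /lead_coef size_char_poly /= => ->; rewrite scale1r => /eqP.
  rewrite addrC addr_eq0 => /eqP E.
  rewrite -[in LHS](subnK dj) exprD E mulrN; congr (- _).
  by rewrite big_distrr; apply: eq_bigr => i _; rewrite exprD; exact/esym/scalemxAr.
rewrite mxE summxE absvN absv_sum_le ?mulr_ge0 ?exprn_ge0// => i _.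
rewrite mxE -[X in C * theta ^+ X](subnKC dj) [theta ^+ _]exprD mulrCA.
apply: absvM_le; first exact: char_poly_nilpart_le.
apply: (le_trans (IH _ _ _ _)); first by have := ltn_ord i; lia.
by rewrite ler_wpM2l// ler_wiXn2l// leq_addr.
Qed.

(** The [j]-th difference of the powers of [A] is [B ^+ j * A ^+ k]. One factor [C] bounds [B ^+ j],
    the other bounds [(1 + B) ^+ k], as binomial coefficients have size at most 1. *)
Lemma exp_coef_diff_bounded a b :
  exists C : R, diff_bounded theta C (fun k => (A ^+ k) a b).
Proof.
have [C C0 BC] := nilpart_exp_le; exists (C * C) => j k.
have -> : iter j (@fdiff R K) (fun k => (A ^+ k) a b) k = (B ^+ j * A ^+ k) a b.
  elim: j k => [|j IH] k; first by rewrite expr0 mul1r.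
  rewrite iterS {1}/fdiff !IH.
  have -> : B ^+ j.+1 * A ^+ k = B ^+ j * A ^+ k.+1 - B ^+ j * A ^+ k.
    by rewrite exprSr -mulrA {2}/B mulrBl mul1r -exprS mulrBr.
  by rewrite !mxE.
rewrite mxE absv_sum_le ?mulr_ge0 ?exprn_ge0// => c _.
rewrite mulrAC absvM_le//.
have -> : A = 1 + B by rewrite /B addrC subrK.
rewrite exprDn_comm; last exact/commr_sym/commr1.
rewrite summxE absv_sum_le// => i _; rewrite mulmxnE absvMn_le//.
rewrite expr1n mul1r (le_trans (BC _ _ _))// ler_piMr// exprn_ile1//.
Qed.

End near_unipotent.

(** * Polynomial functions on matrices *)

Section polynomial_functions.
Variables (K : fieldType) (d : nat).

(** Generated as functions, so that closure properties go by induction; [polyfun_poly_eval] and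
    [poly_eval_polyfun] identify them with evaluations of polynomials. *)
Inductive polyfun : ('M[K]_d -> K) -> Prop :=
| polyfun_cst c : polyfun (fun=> c)
| polyfun_coord a b : polyfun (fun A => A a b)
| polyfunD f g : polyfun f -> polyfun g -> polyfun (fun A => f A + g A)
| polyfunM f g : polyfun f -> polyfun g -> polyfun (fun A => f A * g A).

Lemma polyfun_sum (I : Type) (r : seq I) (P : pred I) (F : I -> 'M[K]_d -> K) :
  (forall i, polyfun (F i)) -> polyfun (fun A => \sum_(i <- r | P i) F i A).
Proof.
move=> HF; elim: r => [|i r IH].
  by under eq_fun do rewrite big_nil; exact: polyfun_cst.
under eq_fun do rewrite big_cons; case: (P i) => //.
exact: polyfunD.
Qed.

Lemma polyfun_prod (I : Type) (r : seq I) (P : pred I) (F : I -> 'M[K]_d -> K) :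
  (forall i, polyfun (F i)) -> polyfun (fun A => \prod_(i <- r | P i) F i A).
Proof.
move=> HF; elim: r => [|i r IH].
  by under eq_fun do rewrite big_nil; exact: polyfun_cst.
under eq_fun do rewrite big_cons; case: (P i) => //.
exact: polyfunM.
Qed.

Lemma polyfunX f n : polyfun f -> polyfun (fun A => f A ^+ n).
Proof.
move=> Hf; elim: n => [|n IH]; first exact: polyfun_cst.
by under eq_fun do rewrite exprS; exact: polyfunM.
Qed.

Lemma polyfun_poly_eval (P : mpoly.mpoly (d * d) K) : polyfun (fun A => poly_eval A P).
Proof.
rewrite /poly_eval; under eq_fun do rewrite mpoly.mevalE.
apply: polyfun_sum => m; apply: polyfunM; first exact: polyfun_cst.
apply: polyfun_prod => i; apply: polyfunX.
case/mxvec_indexP: i => a b; under eq_fun do rewrite mxvecE.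
exact: polyfun_coord.
Qed.

Lemma poly_eval_polyfun f : polyfun f -> exists P, forall A, poly_eval A P = f A.
Proof.
elim=> [c|a b|{}f g _ [P Pf] _ [Q Qg]|{}f g _ [P Pf] _ [Q Qg]].
- by exists (mpoly.mpolyC _ c) => A; exact: mpoly.mevalC.
- exists (mpoly.mpolyX K (mpoly.mnm1 (mxvec_index a b))) => A.
  by rewrite /poly_eval mpoly.mevalXU mxvecE.
- by exists (P + Q) => A; rewrite -Pf -Qg; exact: mpoly.mevalD.
- by exists (P * Q) => A; rewrite poly_evalM Pf Qg.
Qed.

Lemma polyfun_mulmxl M f : polyfun f -> polyfun (fun A => f (M *m A)).
Proof.
elim=> [c|a b|{}f g _ IHf _ IHg|{}f g _ IHf _ IHg].
- exact: polyfun_cst.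
- under eq_fun do rewrite mxE.
  by apply: polyfun_sum => i; apply: polyfunM; [exact: polyfun_cst|exact: polyfun_coord].
- exact: polyfunD.
- exact: polyfunM.
Qed.

Lemma polyfun_mulmxr M f : polyfun f -> polyfun (fun A => f (A *m M)).
Proof.
elim=> [c|a b|{}f g _ IHf _ IHg|{}f g _ IHf _ IHg].
- exact: polyfun_cst.
- under eq_fun do rewrite mxE.
  by apply: polyfun_sum => i; apply: polyfunM; [exact: polyfun_coord|exact: polyfun_cst].
- exact: polyfunD.
- exact: polyfunM.
Qed.

(** The size [n] is independent of [d] so that cofactors are covered. *)
Lemma polyfun_det n (F : 'M[K]_d -> 'M[K]_n) :
  (forall a b, polyfun (fun A => F A a b)) -> polyfun (fun A => \det (F A)).
Proof.
move=> HF; apply: polyfun_sum => s; apply: polyfunM; first exact: polyfun_cst.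
by apply: polyfun_prod => i; exact: HF.
Qed.

(** Cramer's rule; the power of the determinant clears denominators, and exponents add under sums
    and products. *)
Lemma polyfun_invmx f : polyfun f -> exists n, exists2 g, polyfun g &
  forall A, A \in unitmx -> g A = \det A ^+ n * f (invmx A).
Proof.
have pdet n : polyfun (fun A => \det A ^+ n).
  by apply: polyfunX; apply: polyfun_det => a b; exact: polyfun_coord.
elim=> [c|a b|{}f g _ [n [f' Hf' fE]] _ [m [g' Hg' gE]]
            |{}f g _ [n [f' Hf' fE]] _ [m [g' Hg' gE]]].
- by exists 0%N, (fun=> c) => [|A _]; [exact: polyfun_cst|rewrite expr0 mul1r].
- exists 1%N, (fun A => \adj A a b) => [|A uA].
    under eq_fun do rewrite mxE.
    apply: polyfunM; first exact: polyfun_cst.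
    apply: polyfun_det => i j; under eq_fun do rewrite !mxE.
    exact: polyfun_coord.
  rewrite expr1 /invmx uA [X in _ * X]mxE mulrA divff ?mul1r//.
  by move: uA; rewrite unitmxE unitfE.
- exists (n + m)%N, (fun A => \det A ^+ m * f' A + \det A ^+ n * g' A) => [|A uA].
    by apply: polyfunD; exact: polyfunM.
  by rewrite fE// gE// exprD; ring.
- exists (n + m)%N, (fun A => f' A * g' A) => [|A uA]; first exact: polyfunM.
  by rewrite fE// gE// exprD; ring.
Qed.

End polynomial_functions.

(** * Connectedness and Zariski closures of matrix groups *)

Lemma connected_between (T : topologicalType) (A B : set T) :
  connected A -> A `<=` B -> B `<=` closure A -> connected B.
Proof.
move=> cA AB BA D [x Dx] [U oU DU] [F cF DF].
have UF z : B z -> U z <-> F z.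
  move=> Bz; split=> zP.
    by have : D z; [rewrite DU|rewrite DF => -[]].
  by have : D z; [rewrite DF|rewrite DU => -[]].
have [Bx Ux] : (B `&` U) x by rewrite -DU.
(* The open [U] meets [A], so connectedness puts all of [A] inside [U], hence inside the closed [F],
   which then contains [closure A]. *)
have [y [Ay Uy]] := BA x Bx U (open_nbhs_nbhs (conj oU Ux)).
have AU : A `&` U = A.
  apply: cA; [by exists y|by exists U|exists F => //].
  by apply/seteqP; split=> z [Az /(UF _ (AB _ Az))].
rewrite DF; apply/seteqP; split=> [z []//|z Bz]; split=> //.
have := BA z Bz; rewrite closureE; apply; split=> // w Aw.
by apply/(UF _ (AB _ Aw)); move: Aw; rewrite -{1}AU => -[].
Qed.

Section zariski.
Variables (K : fieldType) (d : nat).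
Implicit Types (S E : set (zariski_mx K d)) (M A : 'M[K]_d).

Lemma closed_polyfun_zeros f : polyfun f -> closed [set A : zariski_mx K d | f A = 0].
Proof.
move=> /poly_eval_polyfun[P PE]; rewrite -openC.
exists [set P]; congr (~` _); apply/seteqP; split=> A /=.
  by move=> fA _ ->; rewrite PE.
by move=> /(_ P erefl); rewrite PE.
Qed.

Lemma zariski_closed_sep E A : closed E -> ~ E A ->
  exists2 f, polyfun f & (forall M, E M -> f M = 0) /\ f A != 0.
Proof.
rewrite -openC => -[I /(congr1 setC)]; rewrite !setCK => -> /existsNP[P /not_implyP[IP PA]].
exists (fun A => poly_eval A P); first exact: polyfun_poly_eval.
by split; [move=> M /(_ P IP)|exact/eqP].
Qed.

Lemma zariski_closureP S A : closure S A <->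
  forall f, polyfun f -> (forall M, S M -> f M = 0) -> f A = 0.
Proof.
split=> [cA f pf fS|H].
  have := cA; rewrite closureE => /(_ [set A : zariski_mx K d | f A = 0]); apply.
  by split=> //; exact: closed_polyfun_zeros.
apply: contrapT => nA; have [f pf [fS /eqP]] := zariski_closed_sep (@closed_closure _ S) nA.
by apply; apply: H => // M SM; apply: fS; exact: subset_closure.
Qed.

Lemma zariski_mulmxl_continuous M :
  continuous (fun A : zariski_mx K d => M *m A : zariski_mx K d).
Proof.
apply/continuous_closedP => E cE.
rewrite -[X in closed X]/([set A | E (M *m A)]).
rewrite closure_id; apply/seteqP; split; first exact: subset_closure.
move=> A /zariski_closureP cA; apply: contrapT => /(zariski_closed_sep cE)[f pf [fE /eqP]].
by apply; apply: (cA _ (polyfun_mulmxl M pf)) => B /fE.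
Qed.

Lemma connected_mulmxl M S : connected S ->
  connected ([set M *m A | A in S] : set (zariski_mx K d)).
Proof.
move=> cS; apply: connected_continuous_connected => //.
exact/continuous_subspaceT/zariski_mulmxl_continuous.
Qed.

Section zariski_closure_of_group.
Variable S : set 'M[K]_d.
Hypotheses (S1 : S 1%:M) (SM : forall x y, S x -> S y -> S (x *m y)).
Hypotheses (Su : forall x, S x -> x \in unitmx) (SV : forall x, S x -> S (invmx x)).

Local Notation G := (zariski_closure_GL S).
Local Notation G0 := (identity_component G).

Lemma zariski_closure_GL_sub : S `<=` G.
Proof. by move=> x Sx; split; [exact: Su|exact: (@subset_closure (zariski_mx K d))]. Qed.

(** One variable at a time: first the right factor moves to the closure with the left one in [S],
    then the left factor moves. *)
Lemma zariski_closure_GL_mul x y : G x -> G y -> G (x *m y).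
Proof.
have step s z : S s -> G z -> G (s *m z).
  move=> Ss [uz /zariski_closureP cz]; split.
    by rewrite /GL /= unitmx_mul Su.
  apply/zariski_closureP => f pf fS.
  by apply: (cz _ (polyfun_mulmxl s pf)) => M SM'; apply: fS; exact: SM.
move=> [ux /zariski_closureP cx] Gy; split.
  by rewrite /GL /= unitmx_mul ux; case: Gy.
apply/zariski_closureP => f pf fS.
apply: (cx _ (polyfun_mulmxr y pf)) => M SM'.
by have [_ /zariski_closureP cz] := step _ _ SM' Gy; exact: cz.
Qed.

Lemma zariski_closure_GL_inv x : G x -> G (invmx x).
Proof.
move=> [ux /zariski_closureP cx]; split; first by rewrite /GL /= unitmx_inv.
apply/zariski_closureP => f pf fS; have [n [g pg gE]] := polyfun_invmx pf.
have : g x = 0 by apply: cx => // M SM'; rewrite gE ?Su// fS ?mulr0//; exact: SV.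
rewrite gE// => /eqP; rewrite mulf_eq0 expf_eq0.
by move: ux; rewrite /GL /= unitmxE unitfE => /negbTE ->; rewrite andbF => /eqP.
Qed.

Let G1 : G 1%:M. Proof. exact: zariski_closure_GL_sub. Qed.

Let unitG x : G x -> x \in unitmx. Proof. by case. Qed.

Lemma identity_component1 : G0 1%:M.
Proof. exact: (@connected_component_refl (zariski_mx K d)). Qed.

Lemma identity_component_sub : G0 `<=` G.
Proof. exact: (@connected_component_sub (zariski_mx K d)). Qed.

Lemma translate_identity_component x : G x ->
  [set x *m h | h in G0] `<=` connected_component (G : set (zariski_mx K d)) x.
Proof.
move=> Gx; apply: (@connected_component_max (zariski_mx K d) G _ x).
- by exists 1%:M; [exact: identity_component1|rewrite mulmx1].
- move=> _ [h /identity_component_sub Gh <-]; exact: zariski_closure_GL_mul.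
- exact/connected_mulmxl/component_connected.
Qed.

Lemma identity_component_mul x y : G0 x -> G0 y -> G0 (x *m y).
Proof.
move=> G0x G0y; have := same_connected_component G0x.
rewrite -/(identity_component _) => ->.
by apply: translate_identity_component; [exact: identity_component_sub|exists y].
Qed.

(** Translation by the inverse of [x] carries [x] to 1, so 1 lies in the component of that
    inverse. *)
Lemma identity_component_inv x : G0 x -> G0 (invmx x).
Proof.
move=> G0x; have Gx := identity_component_sub G0x.
apply: connected_component_sym.
apply: (translate_identity_component (zariski_closure_GL_inv Gx)).
by exists x => //; rewrite mulVmx// unitG.
Qed.

Lemma identity_component_closed x : G x -> closure (G0 : set (zariski_mx K d)) x -> G0 x.
Proof.
move=> Gx cx.
apply: (@connected_component_max (zariski_mx K d) G
  (G `&` closure (G0 : set (zariski_mx K d)))) => //.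
  by split; [exact: G1|exact/subset_closure/identity_component1].
apply: (@connected_between _ (G0 : set (zariski_mx K d))).
- exact: component_connected.
- by move=> y G0y; split; [exact: identity_component_sub|exact: subset_closure].
- by move=> y [].
Qed.

(** The finitely many cosets of [G0] by elements of [ss] are closed in [G] and cover [S], hence
    cover [G]. In terms of equations, a point outside all of them is separated from [S] by a product
    of polynomials, one for each coset. *)
Lemma zariski_closure_GL_cover (ss : seq 'M[K]_d) : (forall s, s \in ss -> S s) ->
  (forall A, S A -> exists2 s, s \in ss & G0 (invmx s *m A)) ->
  forall A, G A -> exists2 s, s \in ss & G0 (invmx s *m A).
Proof.
move=> ssS cov A GA; apply: contrapT => nA.
have /choice[f Hf] s : exists f, s \in ss -> [/\ polyfun f,
    forall M, G0 M -> f M = 0 & f (invmx s *m A) != 0].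
  have [sss|/negP nss] := boolP (s \in ss); last by exists (fun=> 0).
  have : ~ closure (G0 : set (zariski_mx K d)) (invmx s *m A).
    move=> /identity_component_closed G0A; apply: nA; exists s => //; apply: G0A.
    apply: zariski_closure_GL_mul => //.
    exact/zariski_closure_GL_inv/zariski_closure_GL_sub/ssS.
  move=> /(zariski_closed_sep (@closed_closure _ _))[f pf [fc fA]].
  by exists f => _; split=> // M G0M; apply: fc; exact: subset_closure.
case: GA => _ /zariski_closureP.
(* The default 1 is there because [polyfun_prod] wants a polynomial at every index, while [f s] is
   controlled only for [s] in [ss]. *)
move=> /(_ (fun A => \prod_(s <- ss) if s \in ss then f s (invmx s *m A) else 1)) H.
have : \prod_(s <- ss) (if s \in ss then f s (invmx s *m A) else 1) = 0.
  apply: H.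
    apply: polyfun_prod => s; case: (boolP (s \in ss)) => [/Hf[pf _ _]|_].
      exact: (polyfun_mulmxl (invmx s) pf).
    exact: polyfun_cst.
  move=> M /cov[s sss G0M]; rewrite (big_rem s)//= sss.
  by have [_ f0 _] := Hf s sss; rewrite f0// mul0r.
apply/eqP; rewrite prodf_seq_neq0; apply/allP => s sss /=.
by rewrite sss; have [] := Hf s sss.
Qed.

Lemma pi0_card_le (ss : seq 'M[K]_d) : (forall s, s \in ss -> S s) ->
  (forall A, S A -> exists2 s, s \in ss & G0 (invmx s *m A)) ->
  (pi0 G #<= `I_(size ss))%card.
Proof.
move=> ssS /(zariski_closure_GL_cover ssS) cov.
pose F i := [set nth 0 ss i *m h | h in G0].
apply: (@card_le_trans _ _ _ (F @` `I_(size ss))); last exact: card_image_le.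
apply: subset_card_le => _ [A GA <-]; have [s sss G0A] := cov A GA.
have us : s \in unitmx by exact/Su/ssS.
exists (index s ss); first by rewrite /= index_mem.
rewrite /F nth_index//; apply/seteqP; split=> _ [h G0h <-].
  exists (invmx (invmx s *m A) *m h).
    exact/identity_component_mul/G0h/identity_component_inv.
  rewrite -[A in A *m _](mulKVmx us) -mulmxA mulKVmx//.
  by rewrite unitmx_mul unitmx_inv us unitG.
exists (invmx s *m A *m h); first exact: identity_component_mul.
by rewrite !mulmxA mulmxV// mul1mx.
Qed.

End zariski_closure_of_group.

End zariski.

(** * Zariski connectedness of the set of powers *)

Section powers.
Variables (R : realType) (K : valuedFieldType R) (p d : nat).
Hypothesis p_pr : prime p.
Hypothesis absv_nat : forall n, (0 < n)%N ->
  absv (n%:R : K) = (p%:R^-1 : R) ^+ logn p n.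
Variables (eps : R) (A : 'M[K]_d).
Hypothesis eps_gt0 : 0 < eps.
Hypothesis eps_small : forall m, (0 < m <= d)%N ->
  eps <= ((p%:R^-1 : R) ^+ 2) ^+ d * absv (m%:R : K).
Hypothesis trA : forall k, absv (\tr (A ^+ k.+1) - \tr (A ^+ k)) <= eps.

Lemma polyfun_exp_diff_bounded f : polyfun f ->
  exists C : R, diff_bounded (p%:R^-1 ^+ 2) C (fun k => f (A ^+ k)).
Proof.
have tau0 := pinv_gt0 R p_pr; have tau1 := pinv_le1 R p_pr.
have th0 : 0 < (p%:R^-1 : R) ^+ 2 by rewrite exprn_gt0.
have th1 : (p%:R^-1 : R) ^+ 2 <= 1 by rewrite exprn_ile1// ltW.
elim=> [c|a b|{}f g _ [C fC] _ [C' gC']|{}f g _ [C fC] _ [C' gC']].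
- by exists (absv c); apply: diff_bounded_cst; exact: ltW.
- exact: exp_coef_diff_bounded eps_small trA _ _.
- exists (Num.max C C'); apply: diff_boundedD.
    by apply: diff_bounded_le fC; rewrite ?le_max ?lexx// ltW.
  by apply: diff_bounded_le gC'; rewrite ?le_max ?lexx ?orbT// ltW.
- by exists (C * C'); exact: diff_boundedM.
Qed.

(** A separation would give [f] vanishing on the closed side and [g] vanishing off the open side,
    each nonzero at some power of [A]. Their product vanishes at every power, against
    [diff_bounded_mul_eq0]. *)
Lemma powers_connected : connected (range (fun k => A ^+ k) : set (zariski_mx K d)).
Proof.
move=> B [x Bx] [U oU BU] [F cF BF].
have [[l _ <-] Ul] : (range (fun k => A ^+ k) `&` U) x by rewrite -BU.
rewrite BF; apply/seteqP; split=> [z []//|_ [m _ <-]]; split; first by exists m.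
apply: contrapT => /(zariski_closed_sep cF)[f pf [fF /eqP fm]].
have cU : closed (~` U) by rewrite closedC.
have nU : ~ (~` U) (A ^+ l) by [].
have [g pg [gU /eqP gl]] := zariski_closed_sep cU nU.
have [C fC] := polyfun_exp_diff_bounded pf.
have [C' gC'] := polyfun_exp_diff_bounded pg.
case: (diff_bounded_mul_eq0 p_pr absv_nat fC gC') => [k|f0|g0]; [|exact: fm|exact: gl].
have [Bk|nBk] := pselect (B (A ^+ k)).
  by rewrite fF ?mul0r//; move: Bk; rewrite BF => -[].
rewrite gU ?mulr0// => Uk; apply: nBk; rewrite BU; split=> //; by exists k.
Qed.

End powers.

(** * Finite nets in compact images *)

Section compact_image.
Variables (R : realType) (K : valuedFieldType R) (d : nat) (T : topologicalType).
Hypothesis T_compact : compact [set: T].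
Variable r : T -> 'M[K]_d.
Hypothesis r_cont : continuous r.

Lemma compact_finite_net (e : R) : 0 < e -> exists s : seq T,
  forall x, exists2 y, y \in s & forall a b, absv (r x a b - r y a b) < e.
Proof.
move=> e0.
(* The filter of all sufficiently large finite lists: the near-covering form of compactness along it
   yields one list that works for every point. *)
pose F : set_system (seq T) := filter_from [set: seq T]
  (fun s0 => [set s : seq T | {subset s0 <= s}]).
have FF : Filter F.
  apply: filter_from_filter; first by exists [::].
  move=> s1 s2 _ _; exists (s1 ++ s2) => // s ss.
  by split=> x xs; apply: ss; rewrite mem_cat xs ?orbT.
have near_cov := (compact_near_coveringP _).1 T_compact _ F
  (fun s x => exists2 y, y \in s & forall a b, absv (r x a b - r y a b) < e) FF.
case: near_cov => [x _|s _ /(_ s (fun _ => id)) H]; last by exists s => x; exact: H.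
have nx : \forall x' \near x, forall a b, absv (r x' a b - r x a b) < e.
  have /cvg_ballP /(_ e e0) : r x' @[x' --> x] --> r x by exact: r_cont.
  apply: filterS => x' [_ H] a b.
  have := H a b; rewrite ballEmdist /= => H'.
  by rewrite -absvN opprB; exact: H'.
exists ([set x' | forall a b, absv (r x' a b - r x a b) < e],
        [set s : seq T | x \in s]) => /=.
  split=> //; exists [:: x] => // s; apply; exact: mem_head.
by move=> [x' s] [/= H xs]; exists x.
Qed.

Lemma compact_coef_bounded : exists2 M : R, 0 < M &
  forall x a b, absv (r x a b) <= M.
Proof.
have [s H] := @compact_finite_net 1 ltr01.
pose c y : R := \sum_(ab : 'I_d * 'I_d) absv (r y ab.1 ab.2).
have c_ge0 y : 0 <= c y by apply: sumr_ge0 => ? _; exact: absv_ge0.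
have c_ge y a b : absv (r y a b) <= c y.
  by rewrite /c (bigD1 (a, b))//= lerDl sumr_ge0// => ? _; exact: absv_ge0.
(* The summand 1 absorbs the radius of the net and keeps the bound positive. *)
exists (1 + \sum_(y <- s) c y); first by rewrite ltr_wpDr// sumr_ge0.
move=> x a b; have [y ys xy] := H x.
rewrite -[r x a b](subrK (r y a b)) absvD_le//.
  by rewrite (le_trans (ltW (xy a b)))// lerDl sumr_ge0.
rewrite (le_trans (c_ge y a b))// (big_rem y)//= addrCA lerDl.
by rewrite addr_ge0 ?ler01 ?sumr_ge0.
Qed.

End compact_image.

(** * The absolute value of natural numbers in C_p *)

Lemma Cp_absv_nat (R : realType) (p : nat) (C : valuedFieldType R) n :
  is_Cp p C -> (0 < n)%N -> absv (n%:R : C) = (p%:R^-1 : R) ^+ logn p n.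
Proof.
move=> [Qp [Qpbar [h [i [j [[hE _ _] _ iE [jE _ _]]]]]]] n0.
rewrite -(rmorph_nat j) jE -(rmorph_nat i) iE -(rmorph_nat h) hE /padic_abs.
rewrite pnatr_eq0 gtn_eqF// -[n%:R]/(n%:Z%:~R) numq_int denq_int !absz_nat logn1.
by rewrite sub0r -exprnN exprVn.
Qed.

(** * Trace classes of representations and the bound on components *)

Section representation_classes.
Variables (R : realType) (K : valuedFieldType R) (d : nat) (Gamma : topGroupType).
Hypothesis Gamma_compact : compact [set: Gamma].

(** With [M] bounding all entries of [r], a net of radius [eps / M] controls the trace of
    [(r g - r g') *m r h] uniformly in [h]. *)
Lemma trace_finite_classes (r : Gamma -> 'M[K]_d) (eps : R) :
  continuous_representation r -> 0 < eps -> exists s : seq Gamma,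
  forall g, exists2 g', g' \in s &
    forall h, absv (\tr (r (g * h)%g) - \tr (r (g' * h)%g)) <= eps.
Proof.
move=> [_ rM rc] e0; have [M M0 rM_le] := compact_coef_bounded Gamma_compact rc.
have [s H] := compact_finite_net Gamma_compact rc (divr_gt0 e0 M0).
exists s => g; have [g' g's gg'] := H g; exists g' => // h.
rewrite !rM -raddfB -mulmxBl; apply: absv_sum_le (ltW e0) _ => a _.
rewrite mxE absv_sum_le ?ltW// => b _.
by rewrite -[eps](divfK (lt0r_neq0 M0)) absvM_le// !mxE ltW.
Qed.

Variable p : nat.
Hypothesis p_pr : prime p.
Hypothesis absv_nat : forall n, (0 < n)%N ->
  absv (n%:R : K) = (p%:R^-1 : R) ^+ logn p n.
Variable eps : R.
Hypothesis eps_gt0 : 0 < eps.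
Hypothesis eps_small : forall m, (0 < m <= d)%N ->
  eps <= ((p%:R^-1 : R) ^+ 2) ^+ d * absv (m%:R : K).

Lemma pi0_card_le_of_trace_classes (r : Gamma -> 'M[K]_d) (s : seq Gamma) :
  continuous_representation r ->
  (forall g, exists2 g', g' \in s &
    forall h, absv (\tr (r (g * h)%g) - \tr (r (g' * h)%g)) <= eps) ->
  (pi0 (zariski_closure_GL (range r)) #<= `I_(size s))%card.
Proof.
move=> [r1 rM _] H; rewrite -(size_map r s).
have rVl g : r (g^-1)%g *m r g = 1%:M by rewrite -rM mulVg r1.
have ru g : r g \in unitmx by case/mulmx1_unit: (rVl g).
have rV g : invmx (r g) = r (g^-1)%g.
  by rewrite -[RHS]mulmx1 -(mulmxV (ru g)) mulmxA rVl mul1mx.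
have rX g k : r (g ^+ k)%g = r g ^+ k.
  by elim: k => [|k IH]; rewrite ?expg0 ?r1// expgS rM IH exprS.
have rangeS : range r 1%:M by exists 1%g.
apply: pi0_card_le => //.
- by move=> _ _ [g _ <-] [h _ <-]; exists (g * h)%g.
- by move=> _ [g _ <-].
- by move=> _ [g _ <-]; rewrite rV; exists (g^-1)%g.
- by move=> _ /mapP[g _ ->]; exists g.
move=> _ [g _ <-]; have [g' g's gg'] := H g; exists (r g'); first exact: map_f.
rewrite rV -rM; set x := (g'^-1 * g)%g.
have trx k : absv (\tr (r x ^+ k.+1) - \tr (r x ^+ k)) <= eps.
  (* This choice of [h] makes the two traces those of conjugates by [g'] of [x ^+ k.+1] and
     [x ^+ k]. *)
  rewrite -!rX; have := gg' (x ^+ k * g'^-1)%g.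
  rewrite !mulgA !rM ![\tr (_ *m r (g'^-1)%g)]mxtrace_mulC.
  by rewrite -!rM !mulgA mulVg mul1g -/x -expgS.
have := powers_connected p_pr absv_nat eps_gt0 eps_small trx => cx.
apply: (@connected_component_max (zariski_mx K d) _ (range (fun k => r x ^+ k))) => //.
- by exists 0%N.
- move=> _ [k _ <-]; rewrite -rX.
  by apply: zariski_closure_GL_sub; [move=> _ [y _ <-]|exists (x ^+ k)%g].
- by exists 1%N.
Qed.

End representation_classes.

Theorem theorem2p4 (R : realType) (p : nat) (p_prime : prime p)
    (Cp : valuedFieldType R) (Cp_is_Cp : is_Cp p Cp)
    (Gamma : topGroupType) (Gamma_compact : compact [set: Gamma])
    (d : nat) (rho : nat -> Gamma -> 'M[Cp]_d)
    (rho_rep : forall n, continuous_representation (rho n))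
    (rho_cvg : uniformly_trace_convergent rho) :
  exists N : nat, forall n,
    (pi0 (zariski_closure_GL (range (rho n))) #<= `I_N)%card.
Proof.
have absv_nat n (n0 : (0 < n)%N) := Cp_absv_nat Cp_is_Cp n0.
(* Each [m] with [0 < m <= d] divides [d!], so this single value meets all the smallness
   conditions. *)
pose eps : R := ((p%:R^-1 : R) ^+ 2) ^+ d * absv (d`!%:R : Cp).
have tau0 := pinv_gt0 R p_prime.
have eps0 : 0 < eps.
  by rewrite mulr_gt0 ?exprn_gt0 ?absv_nat ?fact_gt0 ?exprn_gt0.
have eps_small m : (0 < m <= d)%N ->
    eps <= ((p%:R^-1 : R) ^+ 2) ^+ d * absv (m%:R : Cp).
  move=> /dvdn_fact/dvdnP[q dE]; apply: ler_wpM2l; first by rewrite !exprn_ge0// ltW.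
  by rewrite dE natrM absvM ler_piMl ?absv_ge0 ?absv_nat_le1.
have card_le := pi0_card_le_of_trace_classes p_prime absv_nat eps0 eps_small.
have /choice[s Hs] n := trace_finite_classes Gamma_compact (rho_rep n) eps0.
have [N HN] : exists N, forall n g, (N <= n)%N ->
    absv (\tr (rho n g) - \tr (rho N g)) <= eps.
  have [f fcvg] := rho_cvg.
  have := fcvg [set h | forall g, absv (f g - h g) <= eps].
  case=> [|N _ HN].
    apply/uniform_nbhs; exists [set xy | ball xy.1 eps xy.2]; split.
      exact: (entourage_ball _ (PosNum eps0)).
    move=> h Hh g /=; have : ball (f g) eps (h g) by exact: Hh.
    by rewrite ballEmdist; exact: ltW.
  exists N => n g Nn; have Hn := HN n Nn g; have HNN := HN N (leqnn N) g.
  have -> : \tr (rho n g) - \tr (rho N g) =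
      (f g - \tr (rho N g)) - (f g - \tr (rho n g)) by ring.
  exact: absvB_le.
(* The indices up to [N] use their own classes; all later ones reuse those of [N]. *)
exists (\max_(n < N.+1) size (s n)) => n.
have [nN|Nn] := leqP n N.
  apply: card_le_trans (card_le _ _ _ (rho_rep n) (Hs n)) _.
  rewrite card_le_II.
  exact: (leq_bigmax (F := fun n : 'I_N.+1 => size (s n)) (Ordinal (nN : (n < N.+1)%N))).
have Hn g : exists2 g', g' \in s N &
    forall h, absv (\tr (rho n (g * h)%g) - \tr (rho n (g' * h)%g)) <= eps.
  have [g' g's gg'] := Hs N g; exists g' => // h.
  (* Passing through [rho N] twice costs nothing: the ultrametric inequality keeps the bound at
     [eps]. *)
  have -> : \tr (rho n (g * h)%g) - \tr (rho n (g' * h)%g) =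
      (\tr (rho n (g * h)%g) - \tr (rho N (g * h)%g)) +
      (\tr (rho N (g * h)%g) - \tr (rho N (g' * h)%g)) -
      (\tr (rho n (g' * h)%g) - \tr (rho N (g' * h)%g)) by ring.
  by apply: absvB_le; [apply: absvD_le => //|]; apply: HN; exact: ltnW.
apply: card_le_trans (card_le _ _ _ (rho_rep n) Hn) _.
rewrite card_le_II.
exact: (leq_bigmax (F := fun n : 'I_N.+1 => size (s n)) ord_max).
Qed.
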